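(* Let $\pi:E\to M$ be a principal $G$-bundle (with right $G$-action), and let $\tilde g$ be the $G$-invariant metric on $E$ determined by a triple $(g,Q,\mu)$, where $g$ is a metric on $M$, $Q$ is a family of right-invariant metrics on the fibers, and $\mu$ is a principal connection. Under Ricci flow $\partial_t\tilde g=-2\,\mathrm{Ric}(\tilde g)$ of $(E,\tilde g)$, provided it is well-defined (so that $\tilde g(t)$ is a solution through $G$-invariant metrics, and hence is determined by a time-dependent triple $(g,Q,\mu)$), the triple $(g,Q,\mu)$ evolves by $$\partial_t g_{\beta\gamma} = -2\widetilde{\mathrm{Ric}}_{\beta\gamma},\qquad \partial_t Q_{jk} = -2\widetilde{\mathrm{Ric}}_{jk},\qquad \partial_t \mu^k{}_\gamma = -2Q^{jk}\,\widetilde{\mathrm{Ric}}_{j\gamma}.$$ Here $\mu^k{}_\gamma$ denotes the $E_k$ component of $\mu(s_*\partial_\gamma)$, where $s:U\to E$ is a local section over a coordinate chart $U\subset M$, and the other components are taken with respect to the frame $\{E_j, V_\gamma\}$ and the coordinates described in the context.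
   Context: $G$ is a Lie group with Lie algebra $\mathfrak g$. The metric on $E$ determined by $(g,Q,\mu)$ is $\tilde g=\pi^*g+\mathrm{tr}_Q\,\mu\otimes\mu$, i.e. $\tilde g(X,Y)=g(\pi_*X,\pi_*Y)+Q(\mu(X),\mu(Y))$, where $\mu(X)$ is identified with the vertical part of $X$ (by identifying $\mathfrak g$ with the vertical tangent space via the $G$-action), and $Q$ is a choice of metric on the fibers invariant under the right $G$-action, which may depend on the base point $p\in M$. Greek indices refer to the base, Latin indices to the fibers; repeated indices are summed. Let $U\subset M$ be a coordinate chart with coordinates $x^\beta$ and $s:U\to E$ a local section. Let $\{E_i\}$ be a basis of left-invariant vector fields on $G$; through the right $G$-action these give vertical vector fields on $E$ (the fundamental vector fields of the action), again denoted $E_i$. Along $s(U)$ let $V_\beta=s_*\partial_\beta-\mu(s_*\partial_\beta)$ be the horizontal lift of $\partial_\beta$, with $\mu(s_*\partial_\beta)=\mu^k{}_\beta E_k$, and extend $V_\beta$ to $\pi^{-1}(U)$ by $V_\beta=(R_h)_*V_\beta$ for $h\in G$, where $R_h$ is right translation by $h$. Then $Q_{jk}=Q(E_j,E_k)=\tilde g(E_j,E_k)$, $g_{\beta\gamma}=g(\partial_\beta,\partial_\gamma)=\tilde g(V_\beta,V_\gamma)$, $\tilde g(E_j,V_\gamma)=0$, and $Q^{jk}$ is the inverse matrix of $Q_{jk}$. The components of the Ricci tensor $\widetilde{\mathrm{Ric}}$ of $\tilde g$ are $\widetilde{\mathrm{Ric}}_{jk}=\widetilde{\mathrm{Ric}}(E_j,E_k)$,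 $\widetilde{\mathrm{Ric}}_{j\gamma}=\widetilde{\mathrm{Ric}}(E_j,V_\gamma)$, $\widetilde{\mathrm{Ric}}_{\beta\gamma}=\widetilde{\mathrm{Ric}}(V_\beta,V_\gamma)$. The section $s$, the coordinates and the fields $E_i$ are independent of time; the fields $V_\beta$ are defined at each time using $\mu(t)$. The evolution of $\mu^k{}_\gamma$ is understood along $s(U)$. *)

(* Defs.v *)
From HB Require Import structures.
From mathcomp Require Import all_boot all_order all_algebra.
From mathcomp Require Import all_classical all_reals all_analysis.

Set Implicit Arguments.
Unset Strict Implicit.
Unset Printing Implicit Defensive.
Import Order.TTheory GRing.Theory Num.Theory.
Import numFieldNormedType.Exports.
Local Open Scope classical_set_scope.
Local Open Scope ring_scope.

(** * Smooth functions between Euclidean spaces *)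

(* On an open set, this is C^infinity: every iterated partial derivative exists
   and is (Frechet) differentiable. *)
Definition smooth_on (R : realType) (n : nat) (V : normedModType R)
    (A : set 'rV[R]_n) (f : 'rV[R]_n -> V) : Prop :=
  forall (s : seq 'I_n) (x : 'rV[R]_n), A x ->
    differentiable (foldr (fun i (h : 'rV[R]_n -> V) => 'D_'e_i h) f s) x.

(** * Smooth manifolds *)

(* Raw charts; the axioms are in [is_manifold].  [coor c] and [inv_coor c] are
   meaningful on [dom c] and [img c] only, where they are mutually inverse.
   [chart_at p] is a preferred chart around [p]. *)
Record atlas (R : realType) (T : topologicalType) (n : nat) := Atlas {
  chart : Type;
  dom : chart -> set T;
  img : chart -> set 'rV[R]_n;
  coor : chart -> T -> 'rV[R]_n;
  inv_coor : chart -> 'rV[R]_n -> T;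
  chart_at : T -> chart }.

Definition is_manifold (R : realType) (M : topologicalType) (n : nat)
    (aM : atlas R M n) : Prop :=
  [/\ hausdorff_space M,
      @second_countable M,
      forall c : chart aM,
        [/\ open (dom c), open (img c),
            forall p, dom c p -> img c (coor c p) /\ inv_coor c (coor c p) = p,
            forall v, img c v -> dom c (inv_coor c v) /\ coor c (inv_coor c v) = v &
            {in dom c, continuous (coor c)} /\ {in img c, continuous (inv_coor c)}],
      forall p : M, dom (chart_at aM p) p &
      forall c c' : chart aM,
        smooth_on (img c `&` inv_coor c @^-1` dom c') (coor c' \o inv_coor c)].

Definition prod_atlas (R : realType) (M N : topologicalType) (m n : nat)
    (aM : atlas R M m) (aN : atlas R N n) : atlas R (M * N)%type (m + n) :=
  @Atlas R (M * N)%type (m + n) (chart aM * chart aN)%type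
    (fun c => dom c.1 `*` dom c.2)
    (fun c => [set v | img c.1 (lsubmx v) /\ img c.2 (rsubmx v)])
    (fun c z => row_mx (coor c.1 z.1) (coor c.2 z.2))
    (fun c v => (inv_coor c.1 (lsubmx v), inv_coor c.2 (rsubmx v)))
    (fun z => (chart_at aM z.1, chart_at aN z.2)).

Section Manifolds.
Variables (R : realType) (M N : topologicalType) (m n : nat).
Variables (aM : atlas R M m) (aN : atlas R N n).

(* Smoothness of F on the open set A. *)
Definition smooth_map (A : set M) (F : M -> N) : Prop :=
  {in A, continuous F} /\
  forall (c : chart aM) (c' : chart aN),
    smooth_on (img c `&` inv_coor c @^-1` (A `&` F @^-1` dom c'))
              (coor c' \o F \o inv_coor c).

(* The tangent space of M at p is 'rV[R]_m, a vector being represented by its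
   components in the preferred chart at p.  [tdiff F p] is the tangent map
   F_* at p in these representations. *)
Definition tdiff (F : M -> N) (p : M) : 'rV[R]_m -> 'rV[R]_n :=
  'd (coor (chart_at aN (F p)) \o F \o inv_coor (chart_at aM p))
     (coor (chart_at aM p) p).

(* The i-th coordinate vector field of an arbitrary chart c, hence expressed
   at p in the preferred chart at p. *)
Definition coord_field (c : chart aM) (i : 'I_m) (p : M) : 'rV[R]_m :=
  'd (coor (chart_at aM p) \o inv_coor c) (coor c p) 'e_i.

(* b is an inner product on the linear subspace A. *)
Definition inner_on (A : set 'rV[R]_m) (b : 'rV[R]_m -> 'rV[R]_m -> R) : Prop :=
  [/\ forall a u v w, A u -> A v -> A w ->
        b (a *: u + v) w = a * b u w + b v w,
      forall u v, A u -> A v -> b u v = b v u &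
      forall u, A u -> u != 0 -> 0 < b u u].

(** * Riemannian metrics and their Ricci tensor *)

Section Metric.
Variable g : M -> 'rV[R]_m -> 'rV[R]_m -> R.

Definition metric_mx (c : chart aM) (p : M) : 'M[R]_m :=
  \matrix_(i, j) g p (coord_field c i p) (coord_field c j p).

Definition is_metric : Prop :=
  (forall p, inner_on setT (g p)) /\
  forall (c : chart aM) i j,
    smooth_on (img c) (fun v => metric_mx c (inv_coor c v) i j).

Variable c : chart aM.

Local Notation "'d_ i f" := ('D_('e_i : 'rV[R]_m) (f : 'rV[R]_m -> R))
  (at level 10, i at level 8, f at level 9).

(* Gamma^k_(ij) of the Levi-Civita connection, as a function of the
   coordinates in c. *)
Definition christoffel (k i j : 'I_m) (v : 'rV[R]_m) : R :=
  let G a b w := metric_mx c (inv_coor c w) a b in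
  2^-1 * \sum_l invmx (metric_mx c (inv_coor c v)) k l *
    ('d_i (G j l) v + 'd_j (G i l) v - 'd_l (G i j) v).

(* R^l_(ijk), where R(d_i, d_j) d_k = R^l_(ijk) d_l and
   R(X, Y) = [nabla_X, nabla_Y] - nabla_[X, Y]. *)
Definition riemann (l i j k : 'I_m) (v : 'rV[R]_m) : R :=
  'd_i (christoffel l j k) v - 'd_j (christoffel l i k) v
  + \sum_a (christoffel l i a v * christoffel a j k v
            - christoffel l j a v * christoffel a i k v).

(* Ric(Y, Z) is the trace of X |-> R(X, Y) Z. *)
Definition ricci_coef (j k : 'I_m) (v : 'rV[R]_m) : R :=
  \sum_i riemann i i j k v.

End Metric.

(* Ric is a tensor, so that it may be computed in any chart around p; in the
   preferred one the components of u and w are their entries. *)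
Definition ricci (g : M -> 'rV[R]_m -> 'rV[R]_m -> R) (p : M)
    (u w : 'rV[R]_m) : R :=
  let c := chart_at aM p in
  \sum_j \sum_k u 0 j * w 0 k * ricci_coef g c j k (coor c p).

End Manifolds.

Definition has_deriv_within (R : realType) (I : interval R) (f : R -> R)
    (t l : R) : Prop :=
  h^-1 * (f (t + h) - f t) @[h --> within [set h | t + h \in I] 0^'] --> l.

Definition ricci_flow (R : realType) (M : topologicalType) (m : nat)
    (aM : atlas R M m) (I : interval R)
    (g : R -> M -> 'rV[R]_m -> 'rV[R]_m -> R) : Prop :=
  forall t, t \in I ->
    is_metric aM (g t) /\
    forall p u w,
      has_deriv_within I (fun t' => g t' p u w) t (- 2 * ricci aM (g t) p u w).

(** * Lie groups *)

(* A mere join: compatibility of the group law with the topology is part of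
   [is_lie_group]. *)
HB.structure Definition TopGroup := {G of Topological G & Group G}.

Section LieGroups.
Variables (R : realType) (G : TopGroup.type) (r : nat) (aG : atlas R G r).

Definition is_lie_group : Prop :=
  [/\ is_manifold aG,
      smooth_map (prod_atlas aG aG) aG setT (fun z => (z.1 * z.2)%g) &
      smooth_map aG aG setT (fun a => (a^-1)%g)].

Definition left_invariant (X : G -> 'rV[R]_r) : Prop :=
  forall h a, X (h * a)%g = tdiff aG aG (fun b => (h * b)%g) a (X a).

Definition left_invariant_basis (e : 'I_r -> G -> 'rV[R]_r) : Prop :=
  (forall i, left_invariant (e i)) /\
  forall X, left_invariant X ->
    exists! a : 'rV[R]_r, forall h, X h = \sum_i a 0 i *: e i h.

(* The Lie algebra is identified with the tangent space at 1. *)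
Definition Ad (h : G) : 'rV[R]_r -> 'rV[R]_r :=
  tdiff aG aG (fun a => (h * a * h^-1)%g) 1%g.

End LieGroups.

(** * Principal bundles *)

Section PrincipalBundles.
Variables (R : realType).
Variables (M : topologicalType) (n : nat) (aM : atlas R M n).
Variables (E : topologicalType) (d : nat) (aE : atlas R E d).
Variables (G : TopGroup.type) (r : nat) (aG : atlas R G r).
Variables (pi : E -> M) (act : E -> G -> E).

Definition is_principal_bundle : Prop :=
  [/\ is_manifold aM /\ is_manifold aE,
      is_lie_group aG,
      smooth_map aE aM setT pi /\
      smooth_map (prod_atlas aE aG) aE setT (fun z => act z.1 z.2),
      [/\ forall p, act p 1%g = p,
          forall p h k, act (act p h) k = act p (h * k)%g &
          forall p h, pi (act p h) = pi p] &
      forall x : M, exists U (Phi : E -> M * G) (Psi : M * G -> E),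
        [/\ open U /\ U x,
            smooth_map aE (prod_atlas aM aG) (pi @^-1` U) Phi /\
            smooth_map (prod_atlas aM aG) aE (U `*` setT) Psi,
            forall p, U (pi p) -> (Phi p).1 = pi p /\ Psi (Phi p) = p,
            forall z, U z.1 -> pi (Psi z) = z.1 /\ Phi (Psi z) = z &
            forall p h, U (pi p) -> (Phi (act p h)).2 = ((Phi p).2 * h)%g]].

Definition vertical (p : E) : set 'rV[R]_d := [set v | tdiff aE aM pi p v = 0].

Definition rtrans (h : G) (p : E) : E := act p h.

(* The fundamental vector field of an element X of the Lie algebra. *)
Definition fundamental (X : 'rV[R]_r) (p : E) : 'rV[R]_d :=
  tdiff aG aE (act p) 1%g X.

Definition is_connection (mu : E -> 'rV[R]_d -> 'rV[R]_r) : Prop :=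
  [/\ forall p a u v, mu p (a *: u + v) = a *: mu p u + mu p v,
      forall p X, mu p (fundamental X p) = X,
      forall p h v, mu (act p h) (tdiff aE aE (rtrans h) p v)
                    = Ad aG (h^-1)%g (mu p v) &
      forall (c : chart aE) i,
        smooth_on (img c)
          (fun v => mu (inv_coor c v) (coord_field c i (inv_coor c v)))].

(* Q p is only meaningful on vertical vectors at p.  The fundamental fields
   trivialize the vertical bundle, so smoothness is tested on them. *)
Definition is_fiber_metric (Q : E -> 'rV[R]_d -> 'rV[R]_d -> R) : Prop :=
  [/\ forall p, inner_on (vertical p) (Q p),
      forall p h u v, vertical p u -> vertical p v ->
        Q (act p h) (tdiff aE aE (rtrans h) p u) (tdiff aE aE (rtrans h) p v)
        = Q p u v &
      forall (c : chart aE) X Y,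
        smooth_on (img c) (fun v =>
          Q (inv_coor c v) (fundamental X (inv_coor c v))
                           (fundamental Y (inv_coor c v)))].

(* The vertical part of v at p. *)
Definition vert_part (mu : E -> 'rV[R]_d -> 'rV[R]_r) (p : E) (v : 'rV[R]_d) :
  'rV[R]_d := fundamental (mu p v) p.

Definition bundle_metric (g : M -> 'rV[R]_n -> 'rV[R]_n -> R)
    (Q : E -> 'rV[R]_d -> 'rV[R]_d -> R) (mu : E -> 'rV[R]_d -> 'rV[R]_r)
    (p : E) (u v : 'rV[R]_d) : R :=
  g (pi p) (tdiff aE aM pi p u) (tdiff aE aM pi p v)
  + Q p (vert_part mu p u) (vert_part mu p v).

Definition is_section (U : set M) (s : M -> E) : Prop :=
  smooth_map aM aE U s /\ forall x, U x -> pi (s x) = x.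

(* s_* d_beta at s x. *)
Definition section_field (c : chart aM) (s : M -> E) (b : 'I_n) (x : M) :
  'rV[R]_d := tdiff aM aE s x (coord_field c b x).

(* The fields V_beta on the preimage of dom c. *)
Definition is_horizontal_frame (c : chart aM) (s : M -> E)
    (mu : E -> 'rV[R]_d -> 'rV[R]_r) (V : 'I_n -> E -> 'rV[R]_d) : Prop :=
  (forall b x, dom c x ->
     V b (s x) = section_field c s b x
                 - vert_part mu (s x) (section_field c s b x)) /\
  (forall b p h, dom c (pi p) ->
     V b (act p h) = tdiff aE aE (rtrans h) p (V b p)).

End PrincipalBundles.

(* Main.v *)
Require Import Defs.
From HB Require Import structures.
From mathcomp Require Import all_boot all_order all_algebra.
From mathcomp Require Import all_classical all_reals all_analysis.
From mathcomp Require Import ring.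
Import Order.TTheory GRing.Theory Num.Theory.
Import numFieldNormedType.Exports.
Local Open Scope classical_set_scope.
Local Open Scope ring_scope.

(** Evaluate the flow equation of the total metric on vectors that do not
    depend on time.  Three facts turn the result into the evolution of the
    triple.

    A fundamental vector is vertical, so that pairing it with [v] only sees the
    fibre metric: the metric on [E_j] and [v] is [Q E_j] applied to the vertical
    part of [v] ([bundle_metric_fundamental]).  With [v = E_k] this gives the
    equation for [Q].

    Written in the frame [E_j], the same identity is the linear system
    [b = c *m Q], where [c] collects the components of the connection on [v] and
    [b] the products of [v] with the [E_j].  The Gram matrix [Q] is invertible
    ([gram_unitmx]) because the connection recovers [X] from its fundamental
    vector and because a basis of left-invariant fields is independent at the
    identity ([left_invariant_basis_unitmx]).  Now freeze [v] to be the
    horizontal lift [V_b] at time [t].  Then [c] vanishes at time [t], and so its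
    derivative is that of [b], a Ricci component, times the inverse of [Q]
    ([has_deriv_within_solve]).  Along the section the difference of [V_b] and
    the time-independent field [section_field] is a fundamental vector, whose
    value under the connection does not change; hence [c] is, up to a constant,
    the vector of components of the connection on [section_field], and the
    equation for [mu] follows.

    Finally, on the frozen lifts [v] and [v'] of two coordinate fields, the base
    metric is the total metric minus the fibre metric of the vertical parts.
    This last term is a sum of products of two functions that both vanish at
    time [t], so that its derivative is zero ([has_deriv_within_sum0]) and only
    the Ricci term remains.

    The geometry used is that [V_b] projects to the coordinate field and is
    horizontal at every point over the chart, not only on the section
    ([horizontal_frameP]): the group acts transitively on the fibres, and the
    chain rule for tangent maps ([tdiff_comp]) carries both properties along the
    right translations. *)

(** * Differentials of maps between Euclidean spaces *)

(** Altering a map away from a neighbourhood of [x] changes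
    [f \o shift x] by a function that vanishes near [0], hence by an
    [o_ 0 id]. *)
Lemma near_eq_diff {R : realType} {V W : normedModType R} (f f' : V -> W)
    (x : V) :
  (\forall y \near x, f y = f' y) -> differentiable f x ->
  differentiable f' x /\ 'd f' x = 'd f x :> (V -> W).
Proof.
move=> ff' df.
have fx : f' x = f x by rewrite (nbhs_singleton ff').
have delta_o : (f' \o shift x) - (f \o shift x) =o_ 0 id.
  apply/eqoP => _/posnumP[eps]; near=> y.
  rewrite [X in `|X|](_ : _ = 0) ?normr0 ?mulr_ge0//.
  rewrite !fctE /=; apply/eqP; rewrite subr_eq0 eq_sym; apply/eqP.
  by near: y; have := ff'; rewrite (near_shift 0 x) subr0.
have f'E : f' \o shift x = cst (f' x) + 'd f x +o_ 0 id.
  apply: eqaddoE; rewrite fx -[LHS](subrK (f \o shift x)) addrC delta_o.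
  by rewrite (diff_locally df) -addrA addo.
have d'E : 'd f' x = 'd f x :> (V -> W).
  by apply: diff_unique f'E; exact: diff_continuous.
split=> //; apply/diff_locallyP; rewrite d'E; split=> //.
exact: diff_continuous.
Unshelve. all: by end_near. Qed.

(** A linear map on a finite-dimensional space is a finite sum of coordinate
    functions with vector coefficients. *)
Lemma differentiable_linear_rV {R : realType} {n : nat} {V : normedModType R}
    (f : {linear 'rV[R]_n -> V}) (x : 'rV[R]_n) : differentiable f x.
Proof.
have -> : (f : 'rV[R]_n -> V) = \sum_(i < n) (fun v => v 0 i *: f 'e_i).
  apply/funext => v; rewrite fct_sumE [in LHS](row_sum_delta v) linear_sum.
  by apply: eq_bigr => i _; rewrite linearZ.
elim/big_ind: _ => [|g h|i _].
- exact: differentiable_cst.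
- exact: differentiableD.
- exact: (differentiableZl _ (differentiable_coord _ _ _)).
Qed.

(** In product charts, these are the maps that fix one argument. *)
Lemma differentiable_row_mxl {R : realType} {m n : nat} (w : 'rV[R]_n)
    (x : 'rV[R]_m) : differentiable (fun v => row_mx v w) x.
Proof.
have -> : (fun v : 'rV[R]_m => row_mx v w) =
    mulmxr (row_mx 1%:M (0 : 'M[R]_(m, n))) + cst (row_mx 0 w).
  apply/funext => v; rewrite fctE /= mul_mx_row mulmx1 mulmx0 add_row_mx.
  by rewrite addr0 add0r.
apply: differentiableD; first exact: differentiable_linear_rV.
exact: differentiable_cst.
Qed.

Lemma differentiable_row_mxr {R : realType} {m n : nat} (w : 'rV[R]_m)
    (x : 'rV[R]_n) : differentiable (fun v => row_mx w v) x.
Proof.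
have -> : (fun v : 'rV[R]_n => row_mx w v) =
    mulmxr (row_mx (0 : 'M[R]_(n, m)) 1%:M) + cst (row_mx w 0).
  apply/funext => v; rewrite fctE /= mul_mx_row mulmx1 mulmx0 add_row_mx.
  by rewrite addr0 add0r.
apply: differentiableD; first exact: differentiable_linear_rV.
exact: differentiable_cst.
Qed.

(** * Tangent maps *)

(** Continuity has to be required apart: a chart is arbitrary outside its
    domain, so that differentiability of the coordinate expression at one point
    does not force [F] to stay near [F p]. *)
Definition tdifferentiable {R : realType} {M N : topologicalType} {m n : nat}
    (aM : atlas R M m) (aN : atlas R N n) (F : M -> N) (p : M) : Prop :=
  {for p, continuous F} /\
  differentiable (coor (chart_at aN (F p)) \o F \o inv_coor (chart_at aM p))
    (coor (chart_at aM p) p).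

Lemma dom_chart_at {R : realType} {M : topologicalType} {m : nat}
    {aM : atlas R M m} (p : M) (manM : is_manifold aM) :
  dom (chart_at aM p) p.
Proof. by case: manM => _ _ _ + _; apply. Qed.

Lemma chart_atP {R : realType} {M : topologicalType} {m : nat}
    {aM : atlas R M m} (p : M) (manM : is_manifold aM) :
  img (chart_at aM p) (coor (chart_at aM p) p) /\
  inv_coor (chart_at aM p) (coor (chart_at aM p) p) = p.
Proof.
by case: manM => _ _ + /(_ p) Mp _ => /(_ (chart_at aM p))[_ _ + _ _]; apply.
Qed.

Lemma near_inv_coor {R : realType} {M : topologicalType} {m : nat}
    {aM : atlas R M m} {c : chart aM} {p : M} {P : set M}
    (manM : is_manifold aM) :
  dom c p -> (\forall q \near p, P q) ->
  \forall v \near coor c p, P (inv_coor c v).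
Proof.
move=> cp Pp; case: manM => _ _ /(_ c)[_ _ /(_ p cp)[cv cK] _ [_ cont]] _ _.
by have := cont _ (mem_set cv); rewrite /continuous_at cK; apply.
Qed.

Lemma tdiff_linear {R : realType} {M N : topologicalType} {m n : nat}
    (aM : atlas R M m) (aN : atlas R N n) (F : M -> N) (p : M) :
  linear (tdiff aM aN F p).
Proof. by move=> a u v; rewrite /tdiff linearP. Qed.

Lemma tdiff_cst {R : realType} {M N : topologicalType} {m n : nat}
    (aM : atlas R M m) (aN : atlas R N n) (q : N) (p : M) (v : 'rV[R]_m) :
  tdiff aM aN (cst q) p v = 0.
Proof.
by rewrite /tdiff (_ : _ \o _ = cst (coor (chart_at aN q) q)) ?diff_cst.
Qed.

Lemma smooth_tdifferentiable {R : realType} {M N : topologicalType} {m n : nat}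
    {aM : atlas R M m} {aN : atlas R N n} {A : set M} {F : M -> N} {p : M} :
  is_manifold aM -> is_manifold aN ->
  smooth_map aM aN A F -> A p -> tdifferentiable aM aN F p.
Proof.
move=> manM manN [contF smF] Ap; split; first exact: contF (mem_set Ap).
have [cv cK] := chart_atP p manM.
apply: (smF _ _ [::]); split=> //=; rewrite cK; split=> //.
exact: dom_chart_at.
Qed.

(** Joint smoothness is tested in product charts, whose points are row blocks;
    the partial map is the joint one after [row_mx^~ w]. *)
Lemma smooth_tdifferentiable_l {R : realType} {M N P : topologicalType}
    {m n k : nat} {aM : atlas R M m} {aN : atlas R N n} {aP : atlas R P k}
    {F : M -> N -> P} (p : M) (q : N) :
  is_manifold aM -> is_manifold aN -> is_manifold aP ->
  smooth_map (prod_atlas aM aN) aP setT (fun z => F z.1 z.2) ->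
  tdifferentiable aM aP (F^~ q) p.
Proof.
move=> manM manN manP [contF smF].
have [cv cK] := chart_atP p manM; have [dv dK] := chart_atP q manN.
split.
  have /contF cF : (p, q) \in setT by rewrite in_setT.
  exact: (cvg_comp _ _ (cvg_pair cvg_id (cvg_cst q)) cF).
pose cc : chart (prod_atlas aM aN) := (chart_at aM p, chart_at aN q).
pose c' := chart_at aP (F p q).
have df : differentiable (coor c' \o (fun z => F z.1 z.2) \o inv_coor cc)
    (row_mx (coor cc.1 p) (coor cc.2 q)).
  apply: (smF cc c' [::]); rewrite /= row_mxKl row_mxKr cK dK; split=> //.
  by split=> //; exact: dom_chart_at.
have := differentiable_comp (differentiable_row_mxl _ _) df.
by congr (differentiable _ _); apply/funext => v /=;
  rewrite row_mxKl row_mxKr dK.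
Qed.

Lemma smooth_tdifferentiable_r {R : realType} {M N P : topologicalType}
    {m n k : nat} {aM : atlas R M m} {aN : atlas R N n} {aP : atlas R P k}
    {F : M -> N -> P} (p : M) (q : N) :
  is_manifold aM -> is_manifold aN -> is_manifold aP ->
  smooth_map (prod_atlas aM aN) aP setT (fun z => F z.1 z.2) ->
  tdifferentiable aN aP (F p) q.
Proof.
move=> manM manN manP [contF smF].
have [cv cK] := chart_atP p manM; have [dv dK] := chart_atP q manN.
split.
  have /contF cF : (p, q) \in setT by rewrite in_setT.
  exact: (cvg_comp _ _ (cvg_pair (cvg_cst p) cvg_id) cF).
pose cc : chart (prod_atlas aM aN) := (chart_at aM p, chart_at aN q).
pose c' := chart_at aP (F p q).
have df : differentiable (coor c' \o (fun z => F z.1 z.2) \o inv_coor cc)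
    (row_mx (coor cc.1 p) (coor cc.2 q)).
  apply: (smF cc c' [::]); rewrite /= row_mxKl row_mxKr cK dK; split=> //.
  by split=> //; exact: dom_chart_at.
have := differentiable_comp (differentiable_row_mxr _ _) df.
by congr (differentiable _ _); apply/funext => v /=;
  rewrite row_mxKl row_mxKr cK.
Qed.

(** The tangent maps are computed in preferred charts, so the intermediate
    chart at [F p] is used near [p] only: this is where continuity of [F]
    enters. *)
Lemma tdiff_comp {R : realType} {M N P : topologicalType} {m n k : nat}
    {aM : atlas R M m} {aN : atlas R N n} {aP : atlas R P k}
    {F : M -> N} {H : N -> P} {p : M} (v : 'rV[R]_m) :
  is_manifold aM -> is_manifold aN ->
  tdifferentiable aM aN F p -> tdifferentiable aN aP H (F p) ->
  tdiff aM aP (H \o F) p v = tdiff aN aP H (F p) (tdiff aM aN F p v).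
Proof.
move=> manM manN [contF dF] [contH dH]; rewrite /tdiff.
have [_ cK] := chart_atP p manM.
set c := chart_at aM p in dF cK *; set c' := chart_at aN (F p) in dF dH *.
set c'' := chart_at aP _ in dH *.
have Fcp : (coor c' \o F \o inv_coor c) (coor c p) = coor c' (F p).
  by rewrite /= cK.
have dH' : differentiable (coor c'' \o H \o inv_coor c')
    ((coor c' \o F \o inv_coor c) (coor c p)) by rewrite Fcp.
have [|_ ->] := @near_eq_diff _ _ _ _ (coor c'' \o (H \o F) \o inv_coor c) _ _
    (differentiable_comp dF dH').
  have cp : dom c p := dom_chart_at p manM.
  apply: (near_inv_coor (P := fun q =>
    coor c'' (H (inv_coor c' (coor c' (F q)))) = coor c'' (H (F q)))) => //.
  case: manN => _ _ /(_ c')[oc' _ c'K _ _] /(_ (F p)) c'Fp _.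
  near=> q; have [|_ ->//] := c'K (F q).
  by near: q; exact/contF/open_nbhs_nbhs.
by rewrite (diff_comp dF dH') Fcp.
Unshelve. all: by end_near. Qed.

Lemma tdiff_near_id {R : realType} {M : topologicalType} {m : nat}
    {aM : atlas R M m} {F : M -> M} {p : M} (v : 'rV[R]_m) :
  is_manifold aM -> (\forall q \near p, F q = q) -> tdiff aM aM F p v = v.
Proof.
move=> manM Fid; have Fp := nbhs_singleton Fid.
rewrite /tdiff Fp; set c := chart_at aM p.
have cp : dom c p := dom_chart_at p manM.
have [|_ ->] := @near_eq_diff _ _ _ id (coor c \o F \o inv_coor c) (coor c p)
    _ ex_diff; last by rewrite diff_val.
have Fid' := near_inv_coor manM cp Fid.
have imgc : \forall w \near coor c p, img c w.
  case: manM => _ _ /(_ c)[_ oi /(_ p cp)[? _] _ _] _ _.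
  exact: open_nbhs_nbhs.
near=> w => /=.
have -> : F (inv_coor c w) = inv_coor c w by near: w.
case: manM => _ _ /(_ c)[_ _ _ cK _] _ _; have [|_ ->//] := cK w.
by near: w.
Unshelve. all: by end_near. Qed.

(** * Matrix inversion and derivatives within an interval *)

Lemma cvg_sum_ord {R : realType} {T : Type} {F : set_system T} {FF : Filter F}
    {n : nat} {f : 'I_n -> T -> R} {l : 'I_n -> R} :
  (forall i, f i x @[x --> F] --> l i) ->
  \sum_i f i x @[x --> F] --> \sum_i l i.
Proof. by move=> fl; apply: cvg_big => //; exact: add_continuous. Qed.

Lemma cvg_det {R : realType} {T : Type} {F : set_system T} {FF : Filter F}
    {n : nat} {A : T -> 'M[R]_n} {L : 'M[R]_n} :
  (forall i j, A x i j @[x --> F] --> L i j) ->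
  \det (A x) @[x --> F] --> \det L.
Proof.
move=> AL; apply: cvg_big => [|s _]; first exact: add_continuous.
apply: cvgM; first exact: cvg_cst.
by apply: cvg_big => //; exact: mul_continuous.
Qed.

(** Cramer's rule expresses the entries of the inverse as quotients of
    polynomials in the entries of the matrix. *)
Lemma cvg_invmx {R : realType} {T : Type} {F : set_system T} {FF : Filter F}
    {n : nat} {A : T -> 'M[R]_n} {L : 'M[R]_n} : L \in unitmx ->
  (forall i j, A x i j @[x --> F] --> L i j) ->
  forall i j, invmx (A x) i j @[x --> F] --> invmx L i j.
Proof.
move=> Lu AL i j.
have dL0 : \det L != 0 by rewrite -unitfE -unitmxE.
have -> : invmx L i j = (\det L)^-1 * (\adj L) i j by rewrite /invmx Lu mxE.
have AdetE : \forall x \near F,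
    (\det (A x))^-1 * (\adj (A x)) i j = invmx (A x) i j.
  near=> x; have dx0 : \det (A x) != 0.
    by near: x; exact: cvgr_neq0 (cvg_det AL) dL0.
  by rewrite /invmx unitmxE unitfE dx0 [RHS]mxE.
apply: cvg_trans (near_eq_cvg AdetE) _.
apply: cvgM; first by apply: cvgV => //; exact: cvg_det.
rewrite mxE; under eq_cvg do rewrite mxE.
apply: cvgM; first exact: cvg_cst.
by apply: cvg_det => k l; rewrite !mxE; under eq_cvg do rewrite !mxE; exact: AL.
Unshelve. all: by end_near. Qed.

(** The steps [h], tending to [0], along which [has_deriv_within] takes
    difference quotients.  When [t] is isolated in [I] this filter is trivial,
    so that every function has every derivative there. *)
Definition steps {R : realType} (I : interval R) (t : R) : set_system R :=
  within [set h : R | t + h \in I] (0 : R)^'.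

#[local] Instance steps_filter {R : realType} (I : interval R) (t : R) :
  Filter (steps I t).
Proof. exact: within_filter. Qed.

Lemma near_steps_mem {R : realType} (I : interval R) (t : R) :
  \forall h \near steps I t, t + h \in I.
Proof. exact: withinT. Qed.

Lemma near_steps_neq0 {R : realType} (I : interval R) (t : R) :
  \forall h \near steps I t, h != 0.
Proof. by apply: cvg_within; exact: withinT. Qed.

Lemma has_deriv_within_eq {R : realType} {I : interval R} {f f' : R -> R}
    {t l : R} :
  t \in I -> {in I, f =1 f'} -> has_deriv_within I f t l ->
  has_deriv_within I f' t l.
Proof.
move=> tI ff'; apply: cvg_trans; apply: near_eq_cvg.
near=> h; rewrite !ff'//; near: h; exact: near_steps_mem.
Unshelve. all: by end_near. Qed.

Lemma has_deriv_within_continuous {R : realType} {I : interval R} {f : R -> R}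
    {t l : R} : has_deriv_within I f t l ->
  f (t + h) @[h --> steps I t] --> f t.
Proof.
move=> df; have -> : f t = 0 * l + f t by rewrite mul0r add0r.
have idh : h @[h --> steps I t] --> 0.
  by apply: cvg_within_filter; exact: cvg_within.
apply: cvg_trans (cvgD (cvgM idh df) (cvg_cst (f t))).
apply: near_eq_cvg; near=> h; rewrite fctE /= mulVKf ?subrK//.
near: h; exact: near_steps_neq0.
Unshelve. all: by end_near. Qed.

Lemma has_deriv_withinB {R : realType} {I : interval R} {f f' : R -> R}
    {t l l' : R} : has_deriv_within I f t l -> has_deriv_within I f' t l' ->
  has_deriv_within I (fun s => f s - f' s) t (l - l').
Proof.
move=> df df'; apply: cvg_trans (cvgB df df').
by apply: near_eq_cvg; near=> h; rewrite !fctE; ring.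
Unshelve. all: by end_near. Qed.

(** A product of two functions that vanish at [t] vanishes there to second
    order. *)
Lemma has_deriv_within_sum0 {R : realType} {I : interval R} {n : nat}
    {f f' : 'I_n -> R -> R} {t : R} {l l' : 'I_n -> R} :
  (forall i, has_deriv_within I (f i) t (l i)) ->
  (forall i, has_deriv_within I (f' i) t (l' i)) ->
  (forall i, f i t = 0) -> (forall i, f' i t = 0) ->
  has_deriv_within I (fun s => \sum_i f i s * f' i s) t 0.
Proof.
move=> df df' f0 f'0.
pose q i (h : R) := h^-1 * (f i (t + h) - f i t).
have c i : q i h * f' i (t + h) @[h --> steps I t] --> l i * 0.
  apply: cvgM; first exact: df.
  by have := has_deriv_within_continuous (df' i); rewrite f'0.
have lim0 : \sum_i l i * 0 = 0 by rewrite big1// => i _; rewrite mulr0.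
apply: cvg_trans; last by rewrite -lim0; exact: cvg_sum_ord c.
apply: near_eq_cvg; near=> h.
rewrite [X in _ - X]big1 ?subr0 => [|i _]; last by rewrite f0 mul0r.
by rewrite mulr_sumr; apply: eq_bigr => i _; rewrite /q f0 subr0 mulrA.
Unshelve. all: by end_near. Qed.

(** Solving [b = c *m Q] for [c] needs no derivative of the inverse of [Q] at a
    time where [c] vanishes: there [b] vanishes as well, and the difference
    quotient of [c] is that of [b] times the continuous [invmx \o Q]. *)
Lemma has_deriv_within_solve {R : realType} {I : interval R} {r : nat}
    {Q : R -> 'M[R]_r} {c b : R -> 'rV[R]_r} {t : R} {dQ : 'M[R]_r}
    {db : 'rV[R]_r} :
  t \in I -> (forall s, s \in I -> Q s \in unitmx) ->
  (forall s, s \in I -> b s = c s *m Q s) -> c t = 0 ->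
  (forall j k, has_deriv_within I (fun s => Q s j k) t (dQ j k)) ->
  (forall j, has_deriv_within I (fun s => b s 0 j) t (db 0 j)) ->
  forall k, has_deriv_within I (fun s => c s 0 k) t ((db *m invmx (Q t)) 0 k).
Proof.
move=> tI Qu bE ct0 Qd bd k.
have Qc j l : Q (t + h) j l @[h --> steps I t] --> Q t j l.
  exact: has_deriv_within_continuous (Qd j l).
have lim : \sum_j (h^-1 * (b (t + h) 0 j - b t 0 j)) * invmx (Q (t + h)) j k
    @[h --> steps I t] --> (db *m invmx (Q t)) 0 k.
  rewrite mxE; apply: cvg_sum_ord => j; apply: cvgM; first exact: bd.
  exact: cvg_invmx (Qu t tI) Qc j k.
apply: cvg_trans lim; apply: near_eq_cvg; near=> h.
have hI : t + h \in I by near: h; exact: near_steps_mem.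
have -> : c (t + h) = b (t + h) *m invmx (Q (t + h)).
  by rewrite bE// mulmxK// Qu.
rewrite (bE t tI) ct0 mul0mx !mxE subr0 mulr_sumr.
by apply: eq_bigr => j _; rewrite mxE subr0 mulrA.
Unshelve. all: by end_near. Qed.

(** * Gram matrices *)

Lemma inner_suml {R : realType} {m r : nat} {b : 'rV[R]_m -> 'rV[R]_m -> R}
    (u : 'I_r -> 'rV[R]_m) (x : 'rV[R]_r) (y : 'rV[R]_m) :
  inner_on setT b ->
  b (x *m \matrix_j u j) y = \sum_j x 0 j * b (u j) y.
Proof.
move=> [blin _ _]; rewrite mulmx_sum_row.
elim/big_rec2: _ => [|j z w _ <-]; last by rewrite rowK blin.
by have := blin (-1) 0 0 y I I I; rewrite scaler0 addr0 mulN1r addNr.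
Qed.

(** A row vector [v] in the kernel of the Gram matrix is the coordinate vector
    of a null vector of the form. *)
Lemma gram_unitmx {R : realType} {m r : nat} {b : 'rV[R]_m -> 'rV[R]_m -> R}
    (u : 'I_r -> 'rV[R]_m) :
  inner_on setT b -> row_free (\matrix_j u j) ->
  \matrix_(j, k) b (u j) (u k) \in unitmx.
Proof.
move=> bin ufree; have [_ bsym bpos] := bin; rewrite -row_free_unit.
apply: inj_row_free => v vG; set x := v *m \matrix_j u j.
have x0 : b x x = 0.
  rewrite inner_suml// big1// => j _.
  rewrite bsym// inner_suml//.
  rewrite (_ : \sum__ _ = (v *m \matrix_(j, k) b (u j) (u k)) 0 j).
    by rewrite vG mxE mulr0.
  by rewrite mxE; apply: eq_bigr => k _; rewrite mxE.
apply: (row_free_inj ufree); rewrite mul0mx; apply/eqP/negP => /negP xN0.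
by have := bpos x I xN0; rewrite x0 ltxx.
Qed.

(** * Vertical and horizontal vectors on a principal bundle *)

(** A linear relation between the values at [1] propagates to every [h] by the
    left translations, whereas coordinates in a basis of left-invariant fields
    are unique. *)
Lemma left_invariant_basis_unitmx {R : realType} {G : TopGroup.type} {r : nat}
    {aG : atlas R G r} {e : 'I_r -> G -> 'rV[R]_r} :
  left_invariant_basis aG e -> \matrix_j e j 1%g \in unitmx.
Proof.
move=> [einv ebasis]; rewrite -row_free_unit; apply: inj_row_free => v ve.
have inv0 : left_invariant aG (fun=> 0).
  by move=> h a; rewrite /tdiff linear0.
have [w [_ wuniq]] := ebasis _ inv0.
have <- : w = v.
  apply: wuniq => h.
  have eE j : e j h = tdiff aG aG (fun b => (h * b)%g) 1%g (e j 1%g).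
    by rewrite -{1}(mulg1 h) einv.
  have := congr1 (tdiff aG aG (fun b => (h * b)%g) 1%g) ve.
  rewrite mulmx_sum_row /tdiff linear_sum linear0 => eh; rewrite -[LHS]eh.
  by apply: eq_bigr => j _; rewrite linearZ rowK eE.
by apply: wuniq => h; rewrite big1// => i _; rewrite mxE scale0r.
Qed.

(** In a local trivialization the action on a fibre is right multiplication
    in the group. *)
Lemma fiber_transitive {R : realType}
    {M : topologicalType} {n : nat} {aM : atlas R M n}
    {E : topologicalType} {d : nat} {aE : atlas R E d}
    {G : TopGroup.type} {r : nat} {aG : atlas R G r}
    { pi : E -> M} {act : E -> G -> E} {p q : E} :
  is_principal_bundle aM aE aG pi act -> pi p = pi q ->
  exists h, p = act q h.
Proof.
move=> [_ _ _ [_ _ act_pi]].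
move=> /(_ (pi p))[U [Phi [Psi [[_ Up] _ PhiK _ Phi_act]]]].
move=> pq; have Uq : U (pi q) by rewrite -pq.
set h := ((Phi q).2^-1 * (Phi p).2)%g; exists h.
have Uqh : U (pi (act q h)) by rewrite act_pi.
rewrite -(PhiK _ Uqh).2 -{1}(PhiK _ Up).2; congr Psi.
rewrite [LHS]surjective_pairing [RHS]surjective_pairing Phi_act//.
by rewrite (PhiK _ Uqh).1 (PhiK _ Up).1 act_pi pq /h mulVKg.
Qed.

(** The orbit map [act p] stays in one fibre. *)
Lemma tdiff_pi_fundamental {R : realType}
    {M : topologicalType} {n : nat} {aM : atlas R M n}
    {E : topologicalType} {d : nat} {aE : atlas R E d}
    {G : TopGroup.type} {r : nat} {aG : atlas R G r}
    { pi : E -> M} {act : E -> G -> E} (p : E) (X : 'rV[R]_r) :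
  is_principal_bundle aM aE aG pi act ->
  tdiff aE aM pi p (fundamental aE aG act X p) = 0.
Proof.
move=> [[manM manE] [manG _ _] [smpi smact] [act1 _ act_pi] _].
have dact := smooth_tdifferentiable_r p 1%g manE manG manE smact.
have dpi := smooth_tdifferentiable manE manM smpi (I : setT (act p 1%g)).
rewrite /fundamental -{1}(act1 p) -(tdiff_comp _ manG manE dact dpi).
by rewrite (_ : pi \o act p = cst (pi p)) ?tdiff_cst//; apply/funext => h /=.
Qed.

(** Right translations commute with the projection. *)
Lemma tdiff_pi_rtrans {R : realType}
    {M : topologicalType} {n : nat} {aM : atlas R M n}
    {E : topologicalType} {d : nat} {aE : atlas R E d}
    {G : TopGroup.type} {r : nat} {aG : atlas R G r}
    { pi : E -> M} {act : E -> G -> E} (h : G) (p : E) (v : 'rV[R]_d) :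
  is_principal_bundle aM aE aG pi act ->
  tdiff aE aM pi (act p h) (tdiff aE aE (rtrans act h) p v) =
  tdiff aE aM pi p v.
Proof.
move=> [[manM manE] [manG _ _] [smpi smact] [_ _ act_pi] _].
have dact := smooth_tdifferentiable_l p h manE manG manE smact.
have dpi := smooth_tdifferentiable manE manM smpi (I : setT (act p h)).
rewrite -(tdiff_comp _ manE manE dact dpi).
by rewrite (_ : pi \o _ = pi)//; apply/funext => q; exact: act_pi.
Qed.

Lemma tdiff_pi_section_field {R : realType}
    {M : topologicalType} {n : nat} {aM : atlas R M n}
    {E : topologicalType} {d : nat} {aE : atlas R E d}
    {G : TopGroup.type} {r : nat} {aG : atlas R G r}
    { pi : E -> M} {act : E -> G -> E} {c : chart aM} {s : M -> E} {x : M}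
    (b : 'I_n) :
  is_principal_bundle aM aE aG pi act -> is_section aM aE pi (dom c) s ->
  dom c x ->
  tdiff aE aM pi (s x) (section_field aE c s b x) = coord_field c b x.
Proof.
move=> [[manM manE] _ [smpi _] _ _] [sms pisK] cx.
have ds := smooth_tdifferentiable manM manE sms cx.
have dpi := smooth_tdifferentiable manE manM smpi (I : setT (s x)).
rewrite /section_field -(tdiff_comp _ manM manE ds dpi) tdiff_near_id//.
case: manM => _ _ /(_ c)[oc _ _ _ _] _ _.
by near=> y; apply: pisK; near: y; exact: open_nbhs_nbhs.
Unshelve. all: by end_near. Qed.

(** Both properties hold along [s] by construction of [V], and are carried over
    the whole fibre by the equivariance of [V], [pi] and [mu]. *)
Lemma horizontal_frameP {R : realType}
    {M : topologicalType} {n : nat} {aM : atlas R M n}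
    {E : topologicalType} {d : nat} {aE : atlas R E d}
    {G : TopGroup.type} {r : nat} {aG : atlas R G r}
    { pi : E -> M} {act : E -> G -> E} {c : chart aM} {s : M -> E}
    {mu : E -> 'rV[R]_d -> 'rV[R]_r} {V : 'I_n -> E -> 'rV[R]_d}
    (b : 'I_n) (p : E) :
  is_principal_bundle aM aE aG pi act -> is_section aM aE pi (dom c) s ->
  is_connection aE aG act mu -> is_horizontal_frame aE aG pi act c s mu V ->
  dom c (pi p) ->
  tdiff aE aM pi p (V b p) = coord_field c b (pi p) /\ mu p (V b p) = 0.
Proof.
move=> bundle sec conn [Vs Vact] cp; have [mulin mufund muAd _] := conn.
have pis : pi (s (pi p)) = pi p by case: sec => _; apply.
have muB q u v : mu q (u - v) = mu q u - mu q v.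
  by rewrite -scaleN1r addrC mulin scaleN1r addrC.
have [h ->] := fiber_transitive bundle (esym pis).
have act_pi : pi (act (s (pi p)) h) = pi p.
  by case: bundle => _ _ _ [_ _ ->].
rewrite act_pi Vact ?pis// (tdiff_pi_rtrans _ _ _ bundle) muAd Vs//; split.
  rewrite /tdiff linearB -!/(tdiff _ _ _ _ _).
  rewrite (tdiff_pi_fundamental _ _ bundle) subr0.
  exact: tdiff_pi_section_field bundle sec cp.
by rewrite muB mufund subrr /Ad /tdiff linear0.
Qed.

(** * The metric determined by a triple *)

(** Pulled back to the Lie algebra, the fibre metric is definite since the
    connection is a left inverse of [X |-> fundamental X p]. *)
Lemma inner_on_fundamental {R : realType}
    {M : topologicalType} {n : nat} {aM : atlas R M n}
    {E : topologicalType} {d : nat} {aE : atlas R E d}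
    {G : TopGroup.type} {r : nat} {aG : atlas R G r}
    { pi : E -> M} {act : E -> G -> E}
    {Q : E -> 'rV[R]_d -> 'rV[R]_d -> R} {mu : E -> 'rV[R]_d -> 'rV[R]_r}
    (p : E) :
  is_principal_bundle aM aE aG pi act ->
  is_fiber_metric aM aE aG pi act Q -> is_connection aE aG act mu ->
  inner_on setT
    (fun X Y => Q p (fundamental aE aG act X p) (fundamental aE aG act Y p)).
Proof.
move=> bundle [/(_ p)[Qlin Qsym Qpos] _ _] [mulin mufund _ _].
have vfund X := tdiff_pi_fundamental p X bundle.
split=> [a u v w _ _ _|u v _ _|u _ u0].
- have -> : fundamental aE aG act (a *: u + v) p =
      a *: fundamental aE aG act u p + fundamental aE aG act v p.
    exact: tdiff_linear.
  by rewrite Qlin//; exact: vfund.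
- by rewrite Qsym//; exact: vfund.
- apply: Qpos; first exact: vfund.
  apply: contra_neq u0 => fu0.
  have := mulin p (-1) 0 0; rewrite scaler0 addr0 scaleN1r addNr.
  by rewrite -(mufund p u) fu0.
Qed.

(** Fundamental vectors have no base component, and the connection leaves them
    unchanged. *)
Lemma bundle_metric_fundamental {R : realType}
    {M : topologicalType} {n : nat} {aM : atlas R M n}
    {E : topologicalType} {d : nat} {aE : atlas R E d}
    {G : TopGroup.type} {r : nat} {aG : atlas R G r}
    { pi : E -> M} {act : E -> G -> E} {g : M -> 'rV[R]_n -> 'rV[R]_n -> R}
    {Q : E -> 'rV[R]_d -> 'rV[R]_d -> R} {mu : E -> 'rV[R]_d -> 'rV[R]_r}
    (p : E) (X : 'rV[R]_r) (v : 'rV[R]_d) :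
  is_principal_bundle aM aE aG pi act -> is_metric aM g ->
  is_connection aE aG act mu ->
  bundle_metric aM aE aG pi act g Q mu p (fundamental aE aG act X p) v =
  Q p (fundamental aE aG act X p) (vert_part aE aG act mu p v).
Proof.
move=> bundle [/(_ (pi p))[glin _ _] _] [_ mufund _ _].
rewrite /bundle_metric (tdiff_pi_fundamental _ _ bundle) /vert_part mufund.
have := glin (-1) 0 0 (tdiff aE aM pi p v) I I I.
by rewrite scaler0 addr0 mulN1r addNr => ->; rewrite add0r.
Qed.

(** * Evolution of the triple *)

Theorem proposition3p3 (R : realType)
  (M : topologicalType) (n : nat) (aM : atlas R M n)
  (E : topologicalType) (d : nat) (aE : atlas R E d)
  (G : TopGroup.type) (r : nat) (aG : atlas R G r)
  (pi : E -> M) (act : E -> G -> E)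
  (bundle : is_principal_bundle aM aE aG pi act)
  (I : interval R)
  (g : R -> M -> 'rV[R]_n -> 'rV[R]_n -> R)
  (Q : R -> E -> 'rV[R]_d -> 'rV[R]_d -> R)
  (mu : R -> E -> 'rV[R]_d -> 'rV[R]_r)
  (g_metric : forall t, t \in I -> is_metric aM (g t))
  (Q_metric : forall t, t \in I -> is_fiber_metric aM aE aG pi act (Q t))
  (mu_connection : forall t, t \in I -> is_connection aE aG act (mu t))
  (gE : R -> E -> 'rV[R]_d -> 'rV[R]_d -> R)
  (gE_triple : forall t, t \in I ->
     gE t = bundle_metric aM aE aG pi act (g t) (Q t) (mu t))
  (flow : ricci_flow aE I gE)
  (c : chart aM) (s : M -> E) (s_section : is_section aM aE pi (dom c) s)
  (e : 'I_r -> G -> 'rV[R]_r) (e_basis : left_invariant_basis aG e)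
  (muc : R -> 'I_r -> 'I_n -> M -> R)
  (mucE : forall t b x, t \in I -> dom c x ->
     mu t (s x) (section_field aE c s b x) = \sum_k muc t k b x *: e k 1%g)
  (V : R -> 'I_n -> E -> 'rV[R]_d)
  (V_frame : forall t, t \in I ->
     is_horizontal_frame aE aG pi act c s (mu t) (V t)) :
  let e_fund (j : 'I_r) (p : E) := fundamental aE aG act (e j 1%g) p in
  let Qmx (t : R) (p : E) : 'M[R]_r :=
    \matrix_(j, k) Q t p (e_fund j p) (e_fund k p) in
  let Ric (t : R) := ricci aE (gE t) in
  forall t, t \in I ->
  [/\ forall (p : E) (b b' : 'I_n), dom c (pi p) ->
        has_deriv_within I (fun t' => metric_mx (g t') c (pi p) b b') t
          (- 2 * Ric t p (V t b p) (V t b' p)),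
      forall (p : E) (j k : 'I_r),
        has_deriv_within I (fun t' => Qmx t' p j k) t
          (- 2 * Ric t p (e_fund j p) (e_fund k p)) &
      forall (x : M) (k : 'I_r) (b : 'I_n), dom c x ->
        has_deriv_within I (fun t' => muc t' k b x) t
          (- 2 * \sum_j invmx (Qmx t (s x)) j k
                        * Ric t (s x) (e_fund j (s x)) (V t b (s x)))].
Proof.
move=> e_fund Qmx Ric t tI.
pose B : 'M[R]_r := \matrix_j e j 1%g.
have Bu : B \in unitmx := left_invariant_basis_unitmx e_basis.
(* The components of the connection in the basis e_j(1) of the Lie algebra. *)
pose coord t' p v := mu t' p v *m invmx B.
have coordB t' p v : coord t' p v *m B = mu t' p v by rewrite mulmxKV.
have Qin t' p (t'I : t' \in I) :=
  inner_on_fundamental p bundle (Q_metric t' t'I) (mu_connection t' t'I).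
have Qmx_unit t' p : t' \in I -> Qmx t' p \in unitmx.
  by move=> t'I; apply: (gram_unitmx _ (Qin t' p t'I)); rewrite row_free_unit.
have gE_fund t' p X v : t' \in I -> gE t' p (fundamental aE aG act X p) v =
    Q t' p (fundamental aE aG act X p) (vert_part aE aG act (mu t') p v).
  move=> t'I; rewrite gE_triple//.
  exact: bundle_metric_fundamental bundle (g_metric t' t'I)
    (mu_connection t' t'I).
have gE_coord t' p v : t' \in I ->
    \row_j gE t' p (e_fund j p) v = coord t' p v *m Qmx t' p.
  move=> t'I; apply/rowP => j; rewrite [LHS]mxE [RHS]mxE.
  rewrite gE_fund// /vert_part -coordB.
  have [_ Qsym _] := Qin t' p t'I.
  rewrite [LHS]Qsym// (inner_suml _ _ _ (Qin t' p t'I)).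
  by apply: eq_bigr => k _; rewrite [Qmx _ _ _ _]mxE.
have dgE p u v := (flow t tI).2 p u v.
have dQ p j k : has_deriv_within I (fun t' => Qmx t' p j k) t
    (- 2 * Ric t p (e_fund j p) (e_fund k p)).
  apply: (has_deriv_within_eq tI _ (dgE p _ _)) => t' t'I /=.
  by rewrite mxE gE_fund// /vert_part; case: (mu_connection t' t'I) => _ ->.
have dcoord p v k : mu t p v = 0 ->
  has_deriv_within I (fun t' => coord t' p v 0 k) t
    (- 2 * \sum_j invmx (Qmx t p) j k * Ric t p (e_fund j p) v).
  move=> muv0.
  pose db : 'rV[R]_r := \row_j (- 2 * Ric t p (e_fund j p) v).
  have -> : - 2 * \sum_j invmx (Qmx t p) j k * Ric t p (e_fund j p) v =
      (db *m invmx (Qmx t p)) 0 k.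
    by rewrite mxE mulr_sumr; apply: eq_bigr => j _; rewrite mxE; ring.
  apply: (@has_deriv_within_solve _ _ _ (fun t' => Qmx t' p)
    (fun t' => coord t' p v) (fun t' => \row_j gE t' p (e_fund j p) v) t
    (\matrix_(j, l) (- 2 * Ric t p (e_fund j p) (e_fund l p))) db tI).
  - by move=> t' t'I; exact: Qmx_unit.
  - by move=> t' t'I; exact: gE_coord.
  - by rewrite /coord muv0 mul0mx.
  - by move=> j l; rewrite mxE.
  - move=> j; rewrite mxE.
    by apply: (has_deriv_within_eq tI _ (dgE p _ _)) => t' t'I; rewrite mxE.
split=> // [p b b' cp|x k b cx].
- have [piV muV0] := horizontal_frameP b p bundle s_section
    (mu_connection t tI) (V_frame t tI) cp.
  have [piV' muV'0] := horizontal_frameP b' p bundle s_section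
    (mu_connection t tI) (V_frame t tI) cp.
  (* The lifts at the fixed time t are used as test vectors at all times. *)
  set v := V t b p in piV muV0 *; set v' := V t b' p in piV' muV'0 *.
  have metricE t' : t' \in I ->
      gE t' p v v' - \sum_k coord t' p v 0 k * gE t' p (e_fund k p) v' =
      metric_mx (g t') c (pi p) b b'.
    move=> t'I; rewrite mxE {1}gE_triple// /bundle_metric piV piV'.
    apply/eqP; rewrite subr_eq; apply/eqP; congr (_ + _).
    rewrite {1}/vert_part -coordB (inner_suml _ _ _ (Qin t' p t'I)).
    by apply: eq_bigr => k _; rewrite gE_fund// /vert_part coordB.
  apply: (has_deriv_within_eq tI metricE).
  rewrite -[X in has_deriv_within _ _ _ X]subr0.
  apply: has_deriv_withinB; first exact: dgE.
  apply: has_deriv_within_sum0 => k.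
  + exact: dcoord.
  + exact: dgE.
  + by rewrite /coord muV0 mul0mx mxE.
  + have := congr1 (fun w : 'rV[R]_r => w 0 k) (gE_coord t p v' tI).
    by rewrite mxE => ->; rewrite /coord muV'0 !mul0mx mxE.
- have pix : pi (s x) = x by case: s_section => _; apply.
  have cpx : dom c (pi (s x)) by rewrite pix.
  have [_ muV0] := horizontal_frameP b (s x) bundle s_section
    (mu_connection t tI) (V_frame t tI) cpx.
  pose row_muc t' : 'rV[R]_r := \row_k muc t' k b x.
  have mucB t' : t' \in I ->
      mu t' (s x) (section_field aE c s b x) = row_muc t' *m B.
    move=> t'I; rewrite mucE// mulmx_sum_row; apply: eq_bigr => j _.
    by rewrite mxE rowK.
  (* V t b differs from the fixed section field by a fundamental vector, on
     which all connections agree. *)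
  have coordV t' : t' \in I ->
      coord t' (s x) (V t b (s x)) = row_muc t' - row_muc t.
    move=> t'I; have [Vs _] := V_frame t tI; rewrite Vs//.
    have [mulin mufund _ _] := mu_connection t' t'I.
    rewrite /coord -scaleN1r addrC mulin /vert_part mufund !mucB//.
    by rewrite scaleN1r addrC -mulmxBl mulmxK.
  have := dcoord (s x) _ k muV0.
  apply: cvg_trans; apply: near_eq_cvg; near=> h.
  rewrite !coordV//; last by near: h; exact: near_steps_mem.
  by rewrite !mxE subrr subr0.
Unshelve. all: by end_near. Qed.
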